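(* Let $\mathbb{G}$ be a pseudo-orientable ribbon graph. Then its quasi-tree generating polynomial \[p_{\mathbb{G}}=\sum_{Q\text{ quasi-tree of }\mathbb{G}}\ \prod_{e\in Q}x_e\in\mathbb{C}[x_e: e\in E(\mathbb{G})]\] is Hurwitz stable.
   Context: A ribbon graph $\mathbb{G}$ is a surface with boundary written as the union of vertex discs and edge discs $E(\mathbb{G})$, meeting in disjoint line segments, each on the boundary of exactly one vertex and one edge, with each edge containing exactly two such segments. For connected $\mathbb{G}$, a quasi-tree is $F\subseteq E(\mathbb{G})$ such that the spanning ribbon subgraph $(V(\mathbb{G}),F)$ has exactly one boundary component; in general, a union of quasi-trees of the components. The partial dual $\mathbb{G}^X$ ($X\subseteq E(\mathbb{G})$) has the same edges and as vertices discs glued along the boundary components of $(V(\mathbb{G}),X)$. A bouquet is a ribbon graph with one vertex; a loop is orientable if together with the vertex it forms an annulus, non-orientable if a Möbius band. A bouquet is pseudo-orientable if its vertex boundary circle is the union of two closed arcs $S_1,S_2$ meeting in exactly two points such that both ends of each orientable loop lie in the interior of one $S_i$ and each non-orientable loop has one end in the interior of each of $S_1,S_2$. A connected ribbon graph is pseudo-orientable if $\mathbb{G}^X$ is a pseudo-orientable bouquet for some quasi-tree $X$; a general ribbon graph is pseudo-orientable if one component is pseudo-orientable and all others are orientable. A polynomial $f\in\mathbb{C}[z_1,\dots,z_n]$ is Hurwitz stable if $f(z_1,\dots,z_n)\neq0$ whenever $\mathrm{Re}(z_i)>0$ for all $i$. *)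

(* Defs.v *)
(* Ribbon graphs are encoded combinatorially by their
   "flags" (graph-encoded maps / gems). *)
From HB Require Import structures.
From mathcomp Require Import all_boot all_algebra.
From mathcomp Require Import Rstruct complex.
From mathcomp Require Import mpoly.

Set Implicit Arguments.
Unset Strict Implicit.
Unset Printing Implicit Defensive.

Import GRing.Theory Num.Theory.
Local Open Scope ring_scope.

Definition Cplx : Type := (Rdefinitions.R)[i].

(* A ribbon graph with n edges, labelled by 'I_n.
   Flags = corners of the edge rectangles (4 per edge): each end of each
   attaching segment.
   - ra x : the other end of the attaching segment containing x
            (segment = edge disc  /\  vertex disc);
   - rb x : the corner at the other end of the same long side of the edge
            rectangle (long sides = edge-disc boundary not in a vertex);
   - rg x : the other end of the free arc of the vertex boundary
            (vertex boundary not meeting any edge) starting at x;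
   - redge x : the edge whose rectangle has corner x.
   Vertices with at least one incident edge are the orbits of <ra,rg>;
   vertices with no incident edges (isolated vertices) carry no flags and
   are counted by rv_iso. *)
Record ribbon_graph (n : nat) := RibbonGraph {
  rflag : finType;
  rv_iso : nat;
  ra : rflag -> rflag;
  rb : rflag -> rflag;
  rg : rflag -> rflag;
  redge : rflag -> 'I_n;
  ra_inv : involutive ra;
  rb_inv : involutive rb;
  rg_inv : involutive rg;
  ra_fpf : forall x, ra x != x;
  rb_fpf : forall x, rb x != x;
  rg_fpf : forall x, rg x != x;
  rab_comm : forall x, ra (rb x) = rb (ra x);
  rab_fpf : forall x, ra (rb x) != x;
  redge_a : forall x, redge (ra x) = redge x;
  redge_b : forall x, redge (rb x) = redge x;
  redge_fib : forall x y, redge x = redge y ->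
                [\/ y = x, y = ra x, y = rb x | y = ra (rb x)];
  redge_surj : forall e : 'I_n, exists x, redge x = e
}.

Arguments ra {n} r _.
Arguments rb {n} r _.
Arguments rg {n} r _.
Arguments redge {n} r _.
Arguments rv_iso {n} r.

Section RibbonDefs.
Variables (n : nat) (G : ribbon_graph n).
Local Notation D := (rflag G).

Definition swap_on (F : {set 'I_n}) (f1 f2 : D -> D) : D -> D :=
  fun x => if redge G x \in F then f2 x else f1 x.

Definition rel2 (f g : D -> D) : rel D := fun x y => (y == f x) || (y == g x).
Definition rel3 (f g h : D -> D) : rel D :=
  fun x y => [|| y == f x, y == g x | y == h x].

Definition comp (x : D) : {set D} := [set y | connect (rel3 (ra G) (rb G) (rg G)) x y].

Definition ncycles (S : {set D}) (f g : D -> D) : nat :=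
  #|[set [set y in S | connect (rel2 f g) x y] | x in S]|.

(* Boundary components of the spanning ribbon subgraph (V, F) are the orbits
   of <b_F, rg>, where b_F = rb on flags of edges in F and ra otherwise. *)
Definition bdry_map (F : {set 'I_n}) : D -> D := swap_on F (ra G) (rb G).

(* F is a quasi-tree: in every connected component C of G, the spanning
   ribbon subgraph (V(C), F /\ E(C)) has exactly one boundary component
   (components consisting of an isolated vertex trivially satisfy this). *)
Definition quasi_tree (F : {set 'I_n}) : bool :=
  [forall x : D, ncycles (comp x) (bdry_map F) (rg G) == 1%N].

(* The partial dual G^X has the same flags and edges, with
   attaching-segment map  swap_on X ra rb  and long-side map
   swap_on X rb ra  (the roles of ra/rb are exchanged on edges of X). *)
Definition pd_a (X : {set 'I_n}) : D -> D := swap_on X (ra G) (rb G).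
Definition pd_b (X : {set 'I_n}) : D -> D := swap_on X (rb G) (ra G).

(* In a ribbon graph given by maps (a, b, rg) restricted to the component
   with flag set S which is a bouquet, the loop containing flag y is
   orientable iff the ribbon subgraph formed by the vertex and that loop is
   an annulus, i.e. has two boundary components. *)
Definition loop_orientable (S : {set D}) (a b : D -> D) (y : D) : bool :=
  ncycles S (swap_on [set redge G y] a b) (rg G) == 2%N.

(* The component S of the ribbon graph (a, b, rg) is a pseudo-orientable
   bouquet: one vertex, and the vertex circle splits into two closed arcs
   S_1, S_2 meeting in two points (side y says in which arc the attaching
   segment of y lies; the arcs change only inside at most two free arcs,
   i.e. at most 4 flags y with side (rg y) <> side y), such that a loop has
   both ends in the same arc iff it is orientable. *)
Definition po_bouquet (S : {set D}) (a b : D -> D) : Prop :=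
  ncycles S a (rg G) = 1%N /\
  exists side : D -> bool,
    [/\ forall y, y \in S -> side (a y) = side y,
        (#|[set y in S | side (rg G y) != side y]| <= 4)%N &
        forall y, y \in S ->
          (side (b y) == side y) = loop_orientable S a b y].

Definition po_comp (x : D) : Prop :=
  exists X : {set 'I_n},
    ncycles (comp x) (bdry_map X) (rg G) = 1%N /\
    po_bouquet (comp x) (pd_a X) (pd_b X).

(* The component of x is orientable: its surface admits orientations of all
   vertex and edge discs compatible along the attaching segments, i.e. the
   flag graph is bipartite on it. *)
Definition orientable_comp (x : D) : Prop :=
  exists sgn : D -> bool, forall y, y \in comp x ->
    [&& sgn (ra G y) != sgn y, sgn (rb G y) != sgn y & sgn (rg G y) != sgn y].

(* Pseudo-orientable ribbon graph: one component is pseudo-orientable and all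
   others orientable.  An isolated vertex is a (trivially pseudo-orientable
   and orientable) bouquet without loops. *)
Definition pseudo_orientable : Prop :=
  (exists x : D, po_comp x /\ forall y, y \notin comp x -> orientable_comp y)
  \/ ((0 < rv_iso G)%N /\ forall y : D, orientable_comp y).

Definition qt_poly : {mpoly Cplx[n]} :=
  \sum_(Q : {set 'I_n} | quasi_tree Q) \prod_(e in Q) 'X_e.

End RibbonDefs.

Definition hurwitz_stable (n : nat) (p : {mpoly Cplx[n]}) : Prop :=
  forall z : 'I_n -> Cplx, (forall i, 0 < Re (z i)) -> p.@[z] != 0.

(* Main.v *)
(** Suppose the flags carry a sign that changes along [ra] and [rb], and along
    [rg] outside an [rg]-stable set Z meeting every component, and that F is a
    quasi-tree iff every boundary component of (V, F) meets Z.  On the positive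
    flags let sigma_F send w to [rg (b_F w)], undefined when [b_F w] is in Z.
    Then det (1 - sigma_F) is 1 if F is a quasi-tree (sigma_F is acyclic) and 0
    otherwise.  Each edge e carries two positive flags, and the sum of their two
    rows does not depend on F, so the weighted sum of these determinants is a
    single determinant of a matrix M(x).  A kernel vector of M(x) is, edge by
    edge, the image of its translate along [rg] under a 2x2 map with eigenvalues
    1 and (1 - x_e) / (1 + x_e); as Re x_e > 0 this is a contraction, strict
    except on constants, which forces the vector to be constant on components
    and zero on Z, hence zero.

    On an orientable component Z is one free vertex arc; on a pseudo-orientable
    one, Z consists of the two free arcs where the arcs S_1 and S_2 meet. *)
Require Import Defs.
From mathcomp Require Import all_boot all_order fingroup perm all_algebra.
From mathcomp Require Import Rstruct complex mpoly.
From mathcomp Require Import ring lra.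

Set Implicit Arguments.
Unset Strict Implicit.
Unset Printing Implicit Defensive.

Import Order.TTheory GRing.Theory Num.Theory.
Local Open Scope ring_scope.

(** * Determinants: multilinear expansion and matrices of partial maps *)

Lemma det_col_mx_linear (R : comPzRingType) (m n : nat) (x : 'I_m -> R)
    (A B : 'M[R]_(m, m + n)) (C : 'M[R]_(n, m + n)) :
  \det (col_mx (\matrix_(i, j) (A i j + x i * B i j)) C) =
  \sum_(F : {set 'I_m}) (\prod_(i in F) x i) *
    \det (col_mx (\matrix_(i, j) (if i \in F then B i j else A i j)) C).
Proof.
under [RHS]eq_bigr => F _ do rewrite mulr_sumr.
rewrite exchange_big; apply: eq_bigr => s _ /=.
rewrite big_split_ord /=.
under eq_bigr => i _ do rewrite col_mxEu mxE addrC.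
(* Each top row contributes a sum of two terms; distributing the product picks [B] on a set F of
   rows and [A] on the others. *)
rewrite (bigA_distr 1 +%R) mulr_suml mulr_sumr.
apply: eq_bigr => F _; rewrite big_split_ord /= [RHS]mulrCA; congr (_ * _).
rewrite mulrA; congr (_ * _); last by apply: eq_bigr => i _; rewrite !col_mxEd.
rewrite [LHS](bigID (mem F)) [X in _ = _ * X](bigID (mem F)) /= mulrA -big_split /=.
congr (_ * _); apply: eq_bigr => i iF; rewrite col_mxEu mxE.
  by rewrite iF.
by rewrite (negPf iF).
Qed.

Definition partial_map_mx (R : pzRingType) (N : nat) (f : 'I_N -> option 'I_N) :
  'M[R]_N := \matrix_(i, j) (f i == Some j)%:R.

(* In the Leibniz formula only the identity contributes: a permutation with a
   nonzero term agrees with f on its support, which is then f-stable. *)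
Lemma det_acyclic_map (R : comPzRingType) (N : nat) (f : 'I_N -> option 'I_N) :
    (forall K : {set 'I_N}, K != set0 ->
       ~ forall i, i \in K -> exists2 j, j \in K & f i = Some j) ->
  \det (1%:M - partial_map_mx R f) = 1.
Proof.
move=> acyc; rewrite /determinant (bigD1 (1%g : 'S_N)) //= [X in _ + X]big1 => [|s s1].
  rewrite odd_perm1 expr0 mul1r addr0 big1 // => i _; rewrite !mxE perm1 eqxx.
  case: eqP => [fi|_]; last by rewrite subr0.
  case: (acyc [set i]) => [|j /set1P ->].
    by apply/set0Pn; exists i; rewrite set11.
  by exists i; rewrite ?set11.
have [/existsP[k /andP[sk fk]]|/existsPn nfix] :=
    boolP [exists i, (s i != i) && (f i != Some (s i))].
  rewrite (bigD1 k) //= !mxE (negPf fk) eq_sym (negPf sk).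
  by rewrite subrr mul0r mulr0.
case: (acyc [set i | s i != i]) => [|i]; last first.
  rewrite inE => si; move: (nfix i); rewrite si /= negbK => /eqP fi.
  by exists (s i); rewrite // inE (inj_eq perm_inj).
apply: contra s1 => /eqP K0; apply/eqP/permP => i; rewrite perm1.
by apply/eqP; move/setP/(_ i): K0; rewrite !inE => /negbFE.
Qed.

(** The indicator column of K is fixed by the matrix of f, as i lies in K exactly when [f i] is
    defined and in K; the transpose turns it into the row vector of [det0P]. *)
Lemma det_cyclic_map (R : idomainType) (N : nat) (f : 'I_N -> option 'I_N)
    (K : {set 'I_N}) :
    K != set0 ->
    (forall i, (i \in K) = if f i is Some j then j \in K else false) ->
  \det (1%:M - partial_map_mx R f) = 0.
Proof.
move=> /set0Pn[k kK] stab; rewrite -det_tr; apply/eqP/det0P.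
exists (\row_i (i \in K)%:R).
  by apply/eqP => /rowP/(_ k); rewrite !mxE kK; apply/eqP/oner_neq0.
apply/rowP => i; rewrite !mxE.
under eq_bigr => j _ do rewrite !mxE mulrBr -!natrM !mulnb.
rewrite sumrB (bigD1 i) //= eqxx andbT big1 ?addr0; last first.
  by move=> j /negPf ji; rewrite eq_sym ji andbF.
rewrite stab; case: (f i) => [j|]; last first.
  by rewrite big1 ?subrr // => j _; rewrite andbF.
rewrite (bigD1 j) //= eqxx andbT big1 ?addr0 ?subrr // => l /negPf lj.
by rewrite (inj_eq Some_inj) eq_sym lj andbF.
Qed.

(** * Squared modulus and the contraction at one edge *)

Definition nsq (R : rcfType) (z : R[i]) : R := complex.Re z ^+ 2 + complex.Im z ^+ 2.

Lemma nsq_ge0 (R : rcfType) (z : R[i]) : 0 <= nsq z.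
Proof. by rewrite addr_ge0 ?sqr_ge0. Qed.

Lemma nsq_eq0 (R : rcfType) (z : R[i]) : (nsq z == 0) = (z == 0).
Proof.
case: z => x y; rewrite /nsq /= paddr_eq0 ?sqr_ge0 // !sqrf_eq0.
by rewrite eq_complex.
Qed.

Lemma nsq0 (R : rcfType) : nsq (0 : R[i]) = 0.
Proof. by apply/eqP; rewrite nsq_eq0. Qed.

(* The sum of the pair is preserved and its difference is multiplied by
   (1 - x) / (1 + x), which has modulus < 1 when Re x > 0. *)
Lemma nsq_edge_contract (R : rcfType) (x u v p q : R[i]) :
    0 < complex.Re x -> u + v = p + q -> u - p + x * (u - q) = 0 ->
  nsq u + nsq v <= nsq p + nsq q ?= iff (p == q).
Proof.
case: x u v p q => [x1 x2] [u1 u2] [v1 v2] [p1 p2] [q1 q2] /= x_gt0.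
move=> /eqP; rewrite eq_complex /= => /andP[/eqP e1 /eqP e2].
move=> /eqP; rewrite eq_complex /= => /andP[/eqP e3 /eqP e4].
rewrite eq_complex /= /nsq /=.
have V1 : v1 = p1 + q1 - u1 by lra.
have V2 : v2 = p2 + q2 - u2 by lra.
pose d1 := u1 - v1; pose d2 := u2 - v2.
pose c1 := p1 - q1; pose c2 := p2 - q2.
have E1 : (1 + x1) * d1 - x2 * d2 = (1 - x1) * c1 + x2 * c2.
  by rewrite /d1 /d2 /c1 /c2 V1 V2; lra.
have E2 : (1 + x1) * d2 + x2 * d1 = (1 - x1) * c2 - x2 * c1.
  by rewrite /d1 /d2 /c1 /c2 V1 V2; lra.
have K : ((1 + x1) ^+ 2 + x2 ^+ 2) * (d1 ^+ 2 + d2 ^+ 2) =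
         ((1 - x1) ^+ 2 + x2 ^+ 2) * (c1 ^+ 2 + c2 ^+ 2).
  transitivity (((1 + x1) * d1 - x2 * d2) ^+ 2 + ((1 + x1) * d2 + x2 * d1) ^+ 2).
    by ring.
  by rewrite E1 E2; ring.
have Hd : p1 ^+ 2 + p2 ^+ 2 + (q1 ^+ 2 + q2 ^+ 2) -
          (u1 ^+ 2 + u2 ^+ 2 + (v1 ^+ 2 + v2 ^+ 2)) =
          (c1 ^+ 2 + c2 ^+ 2 - (d1 ^+ 2 + d2 ^+ 2)) / 2.
  have -> : u1 ^+ 2 + u2 ^+ 2 + (v1 ^+ 2 + v2 ^+ 2) =
     ((u1 + v1) ^+ 2 + (u2 + v2) ^+ 2 + (d1 ^+ 2 + d2 ^+ 2)) / 2.
    by rewrite /d1 /d2; field.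
  by rewrite e1 e2 /c1 /c2; field.
have L : 0 < (1 + x1) ^+ 2 + x2 ^+ 2 by have := sqr_ge0 x2; nra.
have Hk : ((1 + x1) ^+ 2 + x2 ^+ 2) * (c1 ^+ 2 + c2 ^+ 2 - (d1 ^+ 2 + d2 ^+ 2)) =
   4 * x1 * (c1 ^+ 2 + c2 ^+ 2) by rewrite mulrBr K; ring.
have c0 : 0 <= c1 ^+ 2 + c2 ^+ 2 by rewrite addr_ge0 ?sqr_ge0.
have Hge : 0 <= c1 ^+ 2 + c2 ^+ 2 - (d1 ^+ 2 + d2 ^+ 2).
  by rewrite -(pmulr_rge0 _ L) Hk mulr_ge0 // mulr_ge0 // ltW.
split; first by rewrite -subr_ge0 Hd divr_ge0.
rewrite eq_sym -subr_eq0 Hd mulf_eq0 invr_eq0 pnatr_eq0 orbF.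
have -> : (c1 ^+ 2 + c2 ^+ 2 - (d1 ^+ 2 + d2 ^+ 2) == 0) =
          (c1 ^+ 2 + c2 ^+ 2 == 0).
  rewrite -(mulrI_eq0 _ (lregP (lt0r_neq0 L))) Hk !mulf_eq0 pnatr_eq0 /=.
  by rewrite (gt_eqF x_gt0).
by rewrite paddr_eq0 ?sqr_ge0 // !sqrf_eq0 !subr_eq0.
Qed.

(** * Partial duals as ribbon graphs *)

Section PartialDual.
Variables (n : nat) (G : ribbon_graph n) (X : {set 'I_n}).
Local Notation D := (rflag G).

Let pa := pd_a (G := G) X.
Let pb := pd_b (G := G) X.

Fact pd_a_inv : involutive pa.
Proof.
by move=> x; rewrite /pa /pd_a /swap_on; case xX: (redge G x \in X);
  rewrite ?redge_a ?redge_b xX ?ra_inv ?rb_inv.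
Qed.

Fact pd_b_inv : involutive pb.
Proof.
by move=> x; rewrite /pb /pd_b /swap_on; case xX: (redge G x \in X);
  rewrite ?redge_a ?redge_b xX ?ra_inv ?rb_inv.
Qed.

Fact pd_a_fpf x : pa x != x.
Proof. by rewrite /pa /pd_a /swap_on; case: ifP; rewrite ?ra_fpf ?rb_fpf. Qed.

Fact pd_b_fpf x : pb x != x.
Proof. by rewrite /pb /pd_b /swap_on; case: ifP; rewrite ?ra_fpf ?rb_fpf. Qed.

Fact pd_ab x : pa (pb x) = ra G (rb G x).
Proof.
rewrite /pa /pb /pd_a /pd_b /swap_on; case xX: (redge G x \in X).
  by rewrite redge_a xX rab_comm.
by rewrite redge_b xX.
Qed.

Fact pd_ab_comm x : pa (pb x) = pb (pa x).
Proof.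
rewrite pd_ab /pa /pb /pd_a /pd_b /swap_on; case xX: (redge G x \in X).
  by rewrite redge_b xX.
by rewrite redge_a xX rab_comm.
Qed.

Fact pd_ab_fpf x : pa (pb x) != x.
Proof. by rewrite pd_ab rab_fpf. Qed.

Fact redge_pd_a x : redge G (pa x) = redge G x.
Proof. by rewrite /pa /pd_a /swap_on; case: ifP; rewrite ?redge_a ?redge_b. Qed.

Fact redge_pd_b x : redge G (pb x) = redge G x.
Proof. by rewrite /pb /pd_b /swap_on; case: ifP; rewrite ?redge_a ?redge_b. Qed.

Fact pd_fib x y : redge G x = redge G y ->
  [\/ y = x, y = pa x, y = pb x | y = pa (pb x)].
Proof.
move/redge_fib; rewrite pd_ab /pa /pb /pd_a /pd_b /swap_on.
by case: ifP => xX [] ->; [constructor 1|constructor 3|constructor 2|constructor 4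
  |constructor 1|constructor 2|constructor 3|constructor 4].
Qed.

(** Through this instance the facts on [ra] also serve [bdry_map F], which is the attaching map of
    the partial dual by F. *)
Definition pdual : ribbon_graph n :=
  RibbonGraph (rv_iso G) pd_a_inv pd_b_inv (@rg_inv n G) pd_a_fpf pd_b_fpf
    (@rg_fpf n G) pd_ab_comm pd_ab_fpf redge_pd_a redge_pd_b pd_fib
    (@redge_surj n G).

End PartialDual.

Lemma connect_ind (T : finType) (e : rel T) (P : T -> Prop) (x y : T) :
  (forall z t, P z -> e z t -> P t) -> P x -> connect e x y -> P y.
Proof.
move=> step + /connectP[p + ->] {y}.
elim: p x => //= z p IHp x Px /andP[xz zp].
by apply: IHp zp; apply: step xz.
Qed.

Lemma rel2_sym (n : nat) (G : ribbon_graph n) (f g : rflag G -> rflag G) :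
  involutive f -> involutive g -> ssrbool.symmetric (rel2 f g).
Proof.
move=> fK gK y z.
by rewrite /rel2 ![z == _]eq_sym (can2_eq fK fK) (can2_eq gK gK).
Qed.

(** * The determinant attached to a sign and a cut set *)

Section Cut.
Variables (n : nat) (G : ribbon_graph n).
Local Notation D := (rflag G).

(** Stand-in for [quasi_tree]: the two agree once Z meets each component of G, in flags that share a
    boundary component for every F. *)
Definition cut_by (Z : {set D}) (F : {set 'I_n}) : bool :=
  [forall x, exists z in Z, connect (rel2 (bdry_map F) (rg G)) x z].

Variables (sgn : D -> bool) (Z : {set D}).
Hypotheses (sgn_a : forall y, sgn (ra G y) = ~~ sgn y)
  (sgn_b : forall y, sgn (rb G y) = ~~ sgn y)
  (sgn_g : forall y, y \notin Z -> sgn (rg G y) = ~~ sgn y)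
  (Z_g : forall y, y \in Z -> rg G y \in Z)
  (Z_comp : forall y, exists2 z, z \in Z & z \in Defs.comp y).

Variable u : 'I_n -> D.
Hypotheses (sgn_u : forall e, sgn (u e)) (redge_u : forall e, redge G (u e) = e).

(** The corners of an edge rectangle alternate in sign, so the positive ones are [u e] and the
    corner opposite to it. *)
Definition pos (i : 'I_(n + n)) : D :=
  match split i with inl e => u e | inr e => ra G (rb G (u e)) end.

Definition idx (w : D) : 'I_(n + n) :=
  if w == u (redge G w) then lshift n (redge G w) else rshift n (redge G w).

Lemma pos_l e : pos (lshift n e) = u e.
Proof. by rewrite /pos (unsplitK (inl e)). Qed.

Lemma pos_r e : pos (rshift n e) = ra G (rb G (u e)).
Proof. by rewrite /pos (unsplitK (inr e)). Qed.

Lemma sgn_pos i : sgn (pos i).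
Proof. by rewrite /pos; case: split => e; rewrite ?sgn_a ?sgn_b ?negbK. Qed.

Lemma idxK w : sgn w -> pos (idx w) = w.
Proof.
move=> sw; rewrite /idx; case: eqP => [wu|wu]; rewrite ?pos_l ?pos_r -?wu //.
case: (redge_fib (redge_u (redge G w))) => E.
- by case: wu.
- by move: sw; rewrite E sgn_a sgn_u.
- by move: sw; rewrite E sgn_b sgn_u.
by [].
Qed.

Lemma posK i : idx (pos i) = i.
Proof.
rewrite /pos -[i in RHS]splitK /idx; case: (split i) => e /=.
  by rewrite redge_u eqxx.
by rewrite redge_a redge_b redge_u (negPf (rab_fpf _)).
Qed.

Lemma sgn_bdry (F : {set 'I_n}) y : sgn (bdry_map F y) = ~~ sgn y.
Proof. by rewrite /bdry_map /swap_on; case: ifP. Qed.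

Definition hop (i : 'I_(n + n)) : option 'I_(n + n) :=
  let y := ra G (pos i) in if y \in Z then None else Some (idx (rg G y)).

Definition step F (i : 'I_(n + n)) : option 'I_(n + n) :=
  let y := bdry_map F (pos i) in if y \in Z then None else Some (idx (rg G y)).

(** [rb] of one positive corner of e is [ra] of the other, so putting e into F exchanges the two
    hops of e. *)
Lemma step_l F e :
  step F (lshift n e) = hop (if e \in F then rshift n e else lshift n e).
Proof.
rewrite /step /hop /bdry_map /swap_on pos_l redge_u.
by case: (e \in F); rewrite ?pos_l ?pos_r ?ra_inv.
Qed.

Lemma step_r F e :
  step F (rshift n e) = hop (if e \in F then lshift n e else rshift n e).
Proof.
rewrite /step /hop /bdry_map /swap_on pos_r redge_a redge_b redge_u.
by case: (e \in F); rewrite ?pos_l ?pos_r // -rab_comm rb_inv.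
Qed.

Lemma stepP F i j :
  step F i = Some j <->
  bdry_map F (pos i) \notin Z /\ pos j = rg G (bdry_map F (pos i)).
Proof.
rewrite /step; case: ifP => [|/negbT] yZ; first by split=> // -[].
have sy : sgn (rg G (bdry_map F (pos i))) by rewrite sgn_g // sgn_bdry negbK sgn_pos.
split=> [[<-]|[_ ej]]; first by rewrite idxK.
by rewrite -ej posK.
Qed.

Lemma rg_notin y : y \notin Z -> rg G y \notin Z.
Proof. by apply: contra => /Z_g; rewrite rg_inv. Qed.

(** A stable set of [step F] traces out boundary components of (V, F) that avoid Z, and each such
    component yields a stable set. *)
Lemma det_step (R : idomainType) F :
  \det (1%:M - partial_map_mx R (step F)) = (cut_by Z F)%:R.
Proof.
have bK : involutive (bdry_map (G := G) F) := @ra_inv n (pdual G F).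
have [cF|] := boolP (cut_by Z F).
  apply: det_acyclic_map => K /set0Pn[k kK] stab.
  have /fin_all_exists[f fP] (i : 'I_(n + n)) :
      exists j, i \in K -> j \in K /\ step F i = Some j.
    have [/stab[j jK ij]|_] := boolP (i \in K); last by exists i.
    by exists j.
  (* [rg] and [bdry_map F] are injective, so [f] permutes K and each flag of K also has a
     predecessor in K. *)
  have f_inj : {in K &, injective f}.
    move=> i j /fP[_ /stepP[_ ei]] /fP[_ /stepP[_ ej]] eij.
    move: ei; rewrite eij ej => /(can_inj (@rg_inv n G)) /(can_inj bK) e.
    by rewrite -[LHS]posK -e posK.
  have fK : f @: K = K.
    apply/eqP; rewrite eqEcard card_in_imset // leqnn andbT.
    by apply/subsetP => _ /imsetP[i iK ->]; case: (fP i iK).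
  (* [O] adds to K the negative flags passed on the way: it is closed under [bdry_map F] and [rg]
     and misses Z, against [cz]. *)
  pose O y := exists2 i, i \in K & y = pos i \/ y = bdry_map F (pos i).
  have notZ y : O y -> y \notin Z.
    case=> i iK [|] ->; last by case: (fP i iK) => _ /stepP[].
    move: iK; rewrite -fK => /imsetP[j jK ->].
    case: (fP j jK) => _ /stepP[jZ ->]; exact: rg_notin.
  have [z zZ cz] := exists_inP (forallP cF (pos k)).
  have /notZ/negP[] // : O z.
  apply: (connect_ind _ _ cz) => [y t [i iK Oy] /orP[]/eqP ->|].
  - by exists i => //; case: Oy => ->; rewrite ?bK; [right|left].
  - case: Oy => ->.
      move: iK; rewrite -fK => /imsetP[j jK ->].
      case: (fP j jK) => _ /stepP[_ ->]; rewrite rg_inv.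
      by exists j; last right.
    by case: (fP i iK) => fiK /stepP[_ <-]; exists (f i); last left.
  - by exists k; last left.
rewrite negb_forall => /existsP[x]; rewrite negb_exists => /forallP xZ.
pose r := rel2 (bdry_map (G := G) F) (rg G).
have r_sym := rel2_sym bK (@rg_inv n G).
have cb y : connect r x (bdry_map F y) = connect r x y.
  by apply/esym/(same_connect_r (sym_connect_sym r_sym))/connect1; rewrite /r /rel2 eqxx.
have cg y : connect r x (rg G y) = connect r x y.
  by apply/esym/(same_connect_r (sym_connect_sym r_sym))/connect1;
     rewrite /r /rel2 eqxx orbT.
apply: (det_cyclic_map _ (K := [set i | connect r x (pos i)])).
  apply/set0Pn; have [sx|sx] := boolP (sgn x).
    by exists (idx x); rewrite inE idxK.
  exists (idx (bdry_map F x)); rewrite inE idxK ?cb //.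
  by rewrite sgn_bdry.
move=> i; rewrite inE; case Es: (step F i) => [j|].
  by case/stepP: Es => _; rewrite inE => ->; rewrite cg cb.
move: Es; rewrite /step; case: ifP => // yZ _.
by apply/negP; rewrite -cb => cx; move: (xZ (bdry_map F (pos i))); rewrite yZ cx.
Qed.

Section Kernel.
Variables (R : rcfType) (z : 'I_n -> R[i]).
Hypothesis z_pos : forall e, 0 < complex.Re (z e).

(** [A] and [B] hold the row of 1 - sigma_F at [lshift n e] for e outside and inside F; [C] holds
    the sum of both rows of e, the same for all F since F only exchanges the two hops. *)
Let H : 'M[R[i]]_(n + n) := partial_map_mx _ hop.
Let A : 'M[R[i]]_(n, n + n) :=
  \matrix_(e, j) ((lshift n e == j)%:R - H (lshift n e) j).
Let B : 'M[R[i]]_(n, n + n) :=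
  \matrix_(e, j) ((lshift n e == j)%:R - H (rshift n e) j).
Let C : 'M[R[i]]_(n, n + n) :=
  \matrix_(e, j) ((lshift n e == j)%:R - H (lshift n e) j
                  + ((rshift n e == j)%:R - H (rshift n e) j)).

Lemma det_edge_rows (F : {set 'I_n}) :
  \det (col_mx (\matrix_(i, j) (if i \in F then B i j else A i j)) C) =
  (cut_by Z F)%:R.
Proof.
rewrite -det_step.
(* The unimodular factor adds the first row of each edge to its second, producing [C]. *)
have <- : \det (block_mx 1%:M 0 1%:M 1%:M : 'M[R[i]]_(n + n)) *
  \det (1%:M - partial_map_mx R[i] (step F)) =
  \det (1%:M - partial_map_mx R[i] (step F)).
  by rewrite det_lblock !det1 !mul1r.
rewrite -det_mulmx -[1%:M - _]vsubmxK mul_block_col !mul1mx mul0mx addr0.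
congr (\det (col_mx _ _)); apply/matrixP => e j; rewrite !mxE step_l ?step_r.
  by case: ifP.
by case: ifP => _ //; ring.
Qed.

Lemma qt_det :
  \sum_(F : {set 'I_n} | cut_by Z F) \prod_(e in F) z e =
  \det (col_mx (\matrix_(i, j) (A i j + z i * B i j)) C).
Proof.
rewrite det_col_mx_linear [LHS]big_mkcond; apply: eq_bigr => F _ /=.
by rewrite det_edge_rows; case: ifP; rewrite (mulr1, mulr0).
Qed.

Lemma cut_sum_neq0 : \sum_(F : {set 'I_n} | cut_by Z F) \prod_(e in F) z e != 0.
Proof.
rewrite qt_det -det_tr; apply/negP => /det0P[f f_neq0 fM].
(* [h] is [f] carried along [hop], with 0 where [hop] is undefined. *)
pose h i := if hop i is Some j then f 0 j else 0.
have dotH i : \sum_j f 0 j * H i j = h i.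
  rewrite /h; under eq_bigr => j _ do rewrite mxE.
  case: (hop i) => [k|]; last by rewrite big1 // => j _; rewrite mulr0.
  rewrite (bigD1 k) //= eqxx mulr1 big1 ?addr0 // => j /negPf jk.
  by rewrite (inj_eq Some_inj) eq_sym jk mulr0.
have dot1 i : \sum_j f 0 j * (i == j)%:R = f 0 i.
  rewrite (bigD1 i) //= eqxx mulr1 big1 ?addr0 // => j /negPf jk.
  by rewrite eq_sym jk mulr0.
have eqC e : f 0 (lshift n e) + f 0 (rshift n e) = h (lshift n e) + h (rshift n e).
  move/rowP/(_ (rshift n e)): fM; rewrite !mxE.
  under eq_bigr => j _ do rewrite mxE col_mxEd mxE mulrDr !mulrBr.
  rewrite !big_split /= !sumrN !dotH !dot1 => /eqP.
  by rewrite addrACA -opprD subr_eq0 => /eqP.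
have eqA e : f 0 (lshift n e) - h (lshift n e) +
             z e * (f 0 (lshift n e) - h (rshift n e)) = 0.
  move/rowP/(_ (lshift n e)): fM; rewrite !mxE.
  under eq_bigr => j _ do
    rewrite mxE col_mxEu mxE [A _ _]mxE [B _ _]mxE mulrDr mulrBr mulrCA mulrBr.
  by rewrite big_split /= sumrB -mulr_sumr sumrB !dot1 !dotH.
have contr e := nsq_edge_contract (z_pos e) (eqC e) (eqA e).
have sum_nsq (k : 'I_(n + n) -> R[i]) : \sum_i nsq (k i) =
    \sum_e (nsq (k (lshift n e)) + nsq (k (rshift n e))).
  by rewrite big_split_ord /= -big_split.
have contr_sum : \sum_i nsq (f 0 i) <= \sum_i nsq (h i) ?= iff
    [forall e, h (lshift n e) == h (rshift n e)].
  by rewrite !sum_nsq; apply: leif_sum.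
pose good := [set i | pos i \notin Z].
have hopP i j : hop i = Some j -> j \in good /\ pos i = ra G (rg G (pos j)).
  have -> : hop i = step set0 i by rewrite /step /bdry_map /swap_on inE.
  case/stepP; rewrite /bdry_map /swap_on inE => iZ pj.
  rewrite inE pj rg_inv ra_inv; split=> //; exact: rg_notin.
(* [hop] is injective with values in [good], so each [f 0 j] is counted at most once. *)
have h_le : \sum_i nsq (h i) <= \sum_(j in good) nsq (f 0 j).
  have -> : \sum_i nsq (h i) = \sum_i \sum_j (hop i == Some j)%:R * nsq (f 0 j).
    apply: eq_bigr => i _; rewrite /h; case: (hop i) => [k|]; last first.
      by rewrite nsq0 big1 // => j _; rewrite mul0r.
    rewrite (bigD1 k) //= eqxx mul1r big1 ?addr0 // => j /negPf jk.
    by rewrite (inj_eq Some_inj) eq_sym jk mul0r.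
  rewrite exchange_big [leRHS]big_mkcond; apply: ler_sum => j _ /=.
  rewrite -mulr_suml; have [[i /eqP ij]|no_i] :=
      altP (existsP (P := fun i => hop i == Some j)).
    have [-> pi] := hopP _ _ ij.
    rewrite (bigD1 i) //= ij eqxx big1 ?addr0 ?mul1r // => k ki.
    case: eqP => // /hopP[_ pk]; case/eqP: ki.
    by rewrite -[LHS]posK pk -pi posK.
  rewrite big1 ?mul0r; first by case: ifP; rewrite ?nsq_ge0.
  by move=> i _; move/existsPn/(_ i)/negPf: no_i => ->.
have good_le : \sum_(j in good) nsq (f 0 j) <= \sum_j nsq (f 0 j).
  by rewrite [leRHS](bigID (mem good)) lerDl sumr_ge0 // => j _; apply: nsq_ge0.
(* The norms of f, of h and of f on [good] bound one another cyclically, so all are equal: the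
   contraction is tight at each edge, and f vanishes off [good]. *)
have h_const e : h (lshift n e) = h (rshift n e).
  apply/eqP; move: e; apply/forallP; rewrite -(contr_sum.2).
  by rewrite eq_le contr_sum.1 (le_trans h_le).
have f_bad j : pos j \in Z -> f 0 j = 0.
  move=> jZ; apply/eqP; rewrite -nsq_eq0; apply/eqP.
  have /psumr_eq0P : \sum_(i | i \notin good) nsq (f 0 i) = 0.
    apply/eqP; rewrite eq_le sumr_ge0 => [|i _]; last exact: nsq_ge0.
    rewrite andbT -(lerD2l (\sum_(j in good) nsq (f 0 j))) addr0.
    have := le_trans contr_sum.1 h_le.
    by rewrite [leLHS](bigID (mem good)).
  by apply=> [i _|]; [exact: nsq_ge0|rewrite inE negbK].
(* With [h] constant on e, [eqA] becomes (1 + z e)(f - h) = 0, and 1 + z e is nonzero as z e has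
   positive real part. *)
have fl e : f 0 (lshift n e) = h (lshift n e).
  have /eqP : (1 + z e) * (f 0 (lshift n e) - h (lshift n e)) = 0.
    by rewrite mulrDl mul1r -[RHS](eqA e) -h_const.
  rewrite mulf_eq0 subr_eq0 => /orP[/eqP z1|/eqP //].
  have := z_pos e; have -> : z e = -1 by apply/eqP; rewrite -addr_eq0 addrC z1.
  by rewrite /= oppr_gt0 ltr10.
have fr e : f 0 (rshift n e) = h (rshift n e).
  by apply: (addrI (f 0 (lshift n e))); rewrite eqC fl.
(* [val] extends f to all flags: a negative flag takes the value at its [rg] neighbour, or 0 in Z,
   so that [val (ra G (pos i))] is [h i]. *)
pose val y :=
  if sgn y then f 0 (idx y) else if y \in Z then 0 else f 0 (idx (rg G y)).
have val_pos i : val (pos i) = f 0 i by rewrite /val sgn_pos posK.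
have val_neg i : val (ra G (pos i)) = h i.
  by rewrite /val sgn_a sgn_pos /h /hop; case: ifP.
have rb_pos e : rb G (pos (lshift n e)) = ra G (pos (rshift n e)) /\
                rb G (pos (rshift n e)) = ra G (pos (lshift n e)).
  by rewrite pos_l pos_r ra_inv rab_comm rb_inv.
have val_ab w : sgn w -> val (ra G w) = val w /\ val (rb G w) = val w.
  move=> /idxK <-; move: (idx w) => k; rewrite -(splitK k).
  case: (split k) => e /=; rewrite val_pos val_neg ?(rb_pos e).1 ?(rb_pos e).2 val_neg.
    by rewrite fl h_const.
  by rewrite fr h_const.
have valZ w : w \in Z -> val w = 0.
  rewrite /val => wZ; case: ifP => [/idxK iw|_]; last by rewrite wZ.
  by rewrite f_bad ?iw.
have val_a w : val (ra G w) = val w.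
  have [/val_ab[]//|sw] := boolP (sgn w).
  by have [|<- _] := val_ab (ra G w); rewrite ?sgn_a ?ra_inv.
have val_b w : val (rb G w) = val w.
  have [/val_ab[]//|sw] := boolP (sgn w).
  by have [|_ <-] := val_ab (rb G w); rewrite ?sgn_b ?rb_inv.
have val_g w : val (rg G w) = val w.
  have [wZ|wZ] := boolP (w \in Z); first by rewrite !valZ ?Z_g.
  rewrite /val sgn_g // (negPf wZ) (negPf (rg_notin wZ)) rg_inv.
  by case: (sgn w).
case/eqP: f_neq0; apply/rowP => i; rewrite mxE -val_pos.
have [t tZ] := Z_comp (pos i); rewrite inE => ct; rewrite -(valZ t tZ).
apply/esym.
apply: (connect_ind (P := fun w => val w = val (pos i)) _ _ ct) => // y w <-.
by case/or3P=> /eqP ->.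
Qed.

End Kernel.
End Cut.

(** * Components and orbit counts *)

Lemma comp_refl (n : nat) (G : ribbon_graph n) (x : rflag G) : x \in Defs.comp x.
Proof. by rewrite inE. Qed.

Lemma comp_closed (n : nat) (G : ribbon_graph n) (x y : rflag G) :
  y \in Defs.comp x ->
  [/\ ra G y \in Defs.comp x, rb G y \in Defs.comp x & rg G y \in Defs.comp x].
Proof.
by rewrite !inE => xy; split; apply: connect_trans xy (connect1 _);
   rewrite /rel3 eqxx ?orbT.
Qed.

Lemma comp_eq (n : nat) (G : ribbon_graph n) (x y : rflag G) :
  y \in Defs.comp x -> Defs.comp y = Defs.comp x.
Proof.
have r_sym : ssrbool.symmetric (rel3 (ra G) (rb G) (rg G)).
  move=> s t; rewrite /rel3 ![t == _]eq_sym (can2_eq (@ra_inv n G) (@ra_inv n G)).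
  by rewrite (can2_eq (@rb_inv n G) (@rb_inv n G)) (can2_eq (@rg_inv n G) (@rg_inv n G)).
rewrite inE => xy; apply/setP => z; rewrite !inE.
by rewrite (same_connect (sym_connect_sym r_sym) xy).
Qed.

Lemma swap_on_closed (n : nat) (G : ribbon_graph n) (S : {set rflag G}) F f1 f2 y :
  f1 y \in S -> f2 y \in S -> swap_on F f1 f2 y \in S.
Proof. by rewrite /swap_on; case: ifP. Qed.

Lemma ncycles1P (n : nat) (G : ribbon_graph n) (S : {set rflag G}) f g x :
    involutive f -> involutive g -> x \in S ->
  reflect (forall y, y \in S -> connect (rel2 f g) x y) (ncycles S f g == 1%N).
Proof.
move=> fK gK xS; have r_sym := sym_connect_sym (rel2_sym fK gK).
apply: (iffP cards1P) => [[B eB] y yS|all_x].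
  have cB z : z \in S -> [set t in S | connect (rel2 f g) z t] = B.
    by move=> zS; apply/set1P; rewrite -eB; apply/imsetP; exists z.
  have : y \in [set t in S | connect (rel2 f g) x t].
    by rewrite (cB x xS) -(cB y yS) inE yS connect0.
  by rewrite inE => /andP[].
exists [set t in S | connect (rel2 f g) x t]; apply/setP => B.
rewrite inE; apply/imsetP/eqP => [[y yS ->]|->]; last by exists x.
by apply/setP => t; rewrite !inE (same_connect r_sym (all_x y yS)).
Qed.

Lemma ncycles_two (n : nat) (G : ribbon_graph n) (S : {set rflag G}) f g x y :
    involutive f -> involutive g -> x \in S -> y \in S ->
    (forall z, z \in S -> connect (rel2 f g) x z \/ connect (rel2 f g) y z) ->
  ncycles S f g = (~~ connect (rel2 f g) x y).+1.
Proof.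
move=> fK gK xS yS cover; have r_sym := sym_connect_sym (rel2_sym fK gK).
pose c z := [set t in S | connect (rel2 f g) z t].
have cE z t : z \in S -> t \in S -> (c z == c t) = connect (rel2 f g) z t.
  move=> zS tS; apply/eqP/idP => [/setP/(_ t)|zt].
    by rewrite !inE tS connect0 /= => ->.
  by apply/setP => w; rewrite !inE (same_connect r_sym zt).
rewrite /ncycles -(cE x y) // -cards2; congr #|pred_of_set _|.
apply/setP => B; rewrite !inE; apply/imsetP/orP => [[z zS ->]|[]/eqP ->].
- by case: (cover z zS) => h; [left|right]; rewrite -/(c z) -/(c _) eq_sym cE.
- by exists x.
- by exists y.
Qed.

Lemma card_flip (T : finType) (f : T -> T) (s : T -> bool) (K : {set T}) (c : bool) :
    involutive f -> (forall y, y \in K -> f y \in K) ->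
    (forall y, y \in K -> s (f y) = ~~ s y) ->
  #|[set y in K | s y == c]| = #|[set y in K | s y != c]|.
Proof.
move=> fK Kf sf; rewrite -(card_imset _ (can_inj fK)); congr #|pred_of_set _|.
apply/setP => y; apply/imsetP/idP => [[z]|].
  by rewrite !inE => /andP[zK /eqP <-] ->; rewrite Kf // sf //; case: (s z).
rewrite inE => /andP[yK yc]; exists (f y); rewrite ?fK // inE Kf // sf //.
by move: yc; case: (s y) c => -[].
Qed.

(** * Alternating cycles of two fixed-point-free involutions *)

Section AlternatingCycle.
Variables (T : finType) (f g : T -> T).
Hypotheses (fK : involutive f) (gK : involutive g).
Hypotheses (f_fpf : forall x, f x != x) (g_fpf : forall x, g x != x).
Let phi := g \o f.

Lemma phi_inj : injective phi.
Proof. exact: inj_comp (can_inj gK) (can_inj fK). Qed.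

(** From phi^(m+2) x = f x, cancelling one phi gives phi^m (phi x) = f (phi x), so the exponent
    drops by two until f or g has a fixed point. *)
Lemma not_fconnect_flip x : ~~ fconnect phi x (f x).
Proof.
apply/negP => /iter_findex; move: (findex _ _ _) => m; move: m x.
apply: ltn_ind => -[|[|m]] IH x.
- by move/eqP; rewrite eq_sym (negPf (f_fpf x)).
- by move/eqP; rewrite /= (negPf (g_fpf _)).
rewrite iterS iterSr => E; apply: (IH m _ (phi x)) => //.
by apply: phi_inj; rewrite E /phi /= fK gK.
Qed.

Lemma fconnect_alternating x y :
  connect (fun y z => (z == f y) || (z == g y)) x y ->
  fconnect phi x y \/ fconnect phi x (f y).
Proof.
pose P y := fconnect phi x y \/ fconnect phi x (f y).
apply: (connect_ind (P := P)) => [{}y z Py /orP[]/eqP ->|]; last by left.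
  by rewrite /P fK; case: Py; [right|left].
case: Py => xy; [right|left].
  apply: connect_trans xy _; rewrite (fconnect_sym phi_inj).
  by apply: connect1; rewrite /= /phi /= fK gK.
by apply: connect_trans xy (connect1 _); rewrite /= /phi /= fK.
Qed.

(** An alternating cycle splits into two orbits of [phi], interchanged by f and by g; for [ra] and
    [rg] this orients a vertex circle. *)
Lemma alternating_bipartite x y :
    connect (fun y z => (z == f y) || (z == g y)) x y ->
  fconnect phi x (f y) = ~~ fconnect phi x y /\
  fconnect phi x (g y) = ~~ fconnect phi x y.
Proof.
move=> xy.
have E : fconnect phi x (f y) = ~~ fconnect phi x y.
  apply/idP/idP => [xfy|]; last by case: (fconnect_alternating xy) => // ->.
  apply: contra (not_fconnect_flip y) => xy'.
  by apply: connect_trans xfy; rewrite (fconnect_sym phi_inj).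
split=> //; rewrite -E.
apply: same_connect_r; first exact: fconnect_sym phi_inj.
by rewrite (fconnect_sym phi_inj); apply: connect1; rewrite /= /phi /= fK.
Qed.

End AlternatingCycle.

(** * Orientability of a loop in a bouquet *)

Section Bouquet.
Variables (n : nat) (G : ribbon_graph n) (S : {set rflag G}).
Hypothesis S_closed :
  forall y, y \in S -> [/\ ra G y \in S, rb G y \in S & rg G y \in S].
Hypothesis S_vertex :
  forall x y, x \in S -> y \in S -> connect (rel2 (ra G) (rg G)) x y.
Variable s : rflag G -> bool.
Hypotheses (s_a : forall y, y \in S -> s (ra G y) = ~~ s y)
  (s_g : forall y, y \in S -> s (rg G y) = ~~ s y).
Variable y : rflag G.
Hypothesis yS : y \in S.

(** The boundary map of the vertex together with the loop of [y] alone. *)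
Let tau := swap_on [set redge G y] (ra G) (rb G).
Let r := rel2 tau (rg G).

Let tauK : involutive tau := @ra_inv n (pdual G [set redge G y]).

Let ayS : ra G y \in S. Proof. by case: (S_closed yS). Qed.
Let byS : rb G y \in S. Proof. by case: (S_closed yS). Qed.
Let abyS : ra G (rb G y) \in S. Proof. by case: (S_closed byS). Qed.

Let tau_e z : redge G z = redge G y -> tau z = rb G z.
Proof. by move=> e; rewrite /tau /swap_on inE e eqxx. Qed.

Let tau_ne z : redge G z != redge G y -> tau z = ra G z.
Proof. by move=> e; rewrite /tau /swap_on inE (negPf e). Qed.

Let r_tau z : r z (tau z). Proof. by rewrite /r /rel2 eqxx. Qed.
Let r_g z : r z (rg G z). Proof. by rewrite /r /rel2 eqxx orbT. Qed.

Let y_by : connect r y (rb G y).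
Proof. by rewrite -tau_e // connect1. Qed.

Let ay_aby : connect r (ra G y) (ra G (rb G y)).
Proof. by rewrite rab_comm -tau_e ?redge_a // connect1. Qed.

Let r_sym := sym_connect_sym (rel2_sym tauK (@rg_inv n G)).

Let r_in_S x z : x \in S -> connect r x z -> z \in S.
Proof.
apply: (connect_ind (P := fun z => z \in S)) => t w /S_closed[ta tb tg].
by case/orP=> /eqP -> //; apply: swap_on_closed.
Qed.

(** A walk along the vertex circle follows the boundary except at corners of the loop, and these lie
    on its two long sides, one through [y] and one through [ra G y]. *)
Lemma cover_two z : z \in S -> connect r y z \/ connect r (ra G y) z.
Proof.
move=> zS; pose P z := connect r y z \/ connect r (ra G y) z.
apply: (connect_ind (P := P) _ _ (S_vertex yS zS)) => [{zS}z t Pz|]; last by left.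
case/orP=> /eqP -> {t}; last first.
  by case: Pz => Pz; [left|right]; apply: connect_trans Pz (connect1 _).
have [ez|ne] := eqVneq (redge G z) (redge G y); last first.
  rewrite -tau_ne //.
  by case: Pz => Pz; [left|right]; apply: connect_trans Pz (connect1 _).
case: (redge_fib (esym ez)) => ->; rewrite ?ra_inv.
- by right.
- by left.
- by right.
- by left.
Qed.

(** By counting: were the long sides on different boundary components, [rg] would balance the signs
    on the one through [ra G y] and [ra] would balance them away from the loop, yet the loop corners
    on it all have one sign. *)
Lemma loop_nonorientable : s (rb G y) = s y -> connect r y (ra G y).
Proof.
move=> sb; apply/negPn/negP => sep.
pose T := [set z | connect r (ra G y) z].
have TS z : z \in T -> z \in S by rewrite inE; apply: r_in_S.
pose K := [set z in T | redge G z != redge G y].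
pose c := s (ra G y).
have T_fib z : z \in T -> redge G z = redge G y -> s z = c.
  move=> zT ez; move: zT; case: (redge_fib (esym ez)) => -> {z ez}.
  - by rewrite inE r_sym (negPf sep).
  - by [].
  - rewrite inE r_sym => h; case/negP: sep; exact: connect_trans y_by h.
  - by rewrite /c s_a // sb s_a.
have cT : #|[set z in T | s z == c]| = #|[set z in T | s z != c]|.
  apply: card_flip (@rg_inv n G) _ _ => z zT; last by rewrite s_g ?TS.
  by move: zT; rewrite !inE => zT; apply: connect_trans zT (connect1 _).
have cK : #|[set z in K | s z == c]| = #|[set z in K | s z != c]|.
  apply: card_flip (@ra_inv n G) _ _ => z; rewrite inE => /andP[zT ez].
    rewrite inE redge_a ez andbT; move: zT; rewrite !inE => zT.
    by apply: connect_trans zT (connect1 _); rewrite -tau_ne.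
  by rewrite s_a ?TS.
have : (#|[set z in K | s z == c]| < #|[set z in T | s z == c]|)%N.
  apply: proper_card; apply/properP; split.
    by apply/subsetP => z; rewrite !inE => /andP[/andP[-> _] ->].
  by exists (ra G y); rewrite !inE ?connect0 ?redge_a ?eqxx.
rewrite cT cK ltnNge subset_leq_card //.
apply/subsetP => z; rewrite [z \in _]inE => /andP[zT zc].
rewrite !inE in zT *; rewrite zT zc andbT.
by apply: contra zc => /eqP ez; rewrite T_fib ?inE.
Qed.

(** The vertex arc from [ra G y] to [ra G (rb G y)] is closed up by the long side joining its ends,
    and it avoids [y]. *)
Lemma loop_annulus : s (rb G y) = ~~ s y -> ~~ connect r (ra G y) y.
Proof.
move=> sb; pose phi := rg G \o ra G.
have phiS z : z \in S -> phi z \in S.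
  by case/S_closed=> zS _ _; rewrite /phi /=; case: (S_closed zS).
have iterS k : iter k phi y \in S by elim: k => //= k; apply: phiS.
have s_iter k : s (iter k phi y) = s y.
  elim: k => //= k IH; rewrite /phi /= s_g ?s_a ?negbK //.
  by case: (S_closed (iterS k)).
have y_aby : fconnect phi y (ra G (rb G y)).
  case: (fconnect_alternating (@ra_inv n G) (@rg_inv n G) (S_vertex yS abyS)) => //.
  by rewrite ra_inv => /iter_findex E; move: sb; rewrite -E s_iter; case: (s y).
pose m := findex phi y (ra G (rb G y)).
have m_lt : (m < fingraph.order phi y)%N := findex_max y_aby.
have iter_m : iter m phi y = ra G (rb G y) := iter_findex y_aby.
have m_gt0 : (0 < m)%N.
  rewrite lt0n; apply/eqP => m0.
  by move: iter_m (rab_fpf y); rewrite m0 /= => <-; rewrite eqxx.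
have idx_iter k : (k <= m)%N -> findex phi y (iter k phi y) = k.
  by move=> km; apply: findex_iter; apply: leq_ltn_trans m_lt.
(* Iterates of [phi] keep the sign of [y], so the only loop corners among them are [y] and the
   opposite one. *)
have e_iter k : (k <= m)%N -> redge G (iter k phi y) = redge G y -> k = 0%N \/ k = m.
  move=> km ek; rewrite -(idx_iter k km).
  case: (redge_fib (esym ek)) => E.
  - by left; rewrite E findex0.
  - by move: (s_iter k); rewrite E s_a //; case: (s y).
  - by move: (s_iter k); rewrite E sb; case: (s y).
  - by right; rewrite E.
(* The range starts at 1 to leave out [y], while [ra G y] enters as [rg] of the first iterate. *)
pose K z := exists2 k, (0 < k <= m)%N & z = iter k phi y \/ z = rg G (iter k phi y).
apply/negP => ry; have : K y.
  apply: (connect_ind (P := K) _ _ ry) => [z t [k km Kz]|]; last first.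
    by exists 1%N; rewrite ?m_gt0 //=; right; rewrite /phi /= rg_inv.
  case/orP=> /eqP -> {t}; last first.
    by exists k => //; case: Kz => ->; rewrite ?rg_inv; [right|left].
  case/andP: (km) => k_gt0 k_le; case: Kz => -> {z}.
    have [ez|ez] := eqVneq (redge G (iter k phi y)) (redge G y).
      rewrite tau_e //; case: (e_iter k k_le ez) => [k0|->].
        by rewrite k0 in k_gt0.
      exists 1%N; rewrite ?m_gt0 //=; right.
      by rewrite iter_m /phi /= rg_inv rab_comm rb_inv.
    exists k.+1 => /=; last by right; rewrite tau_ne // /phi /= rg_inv.
    rewrite ltn_neqAle k_le andbT; apply: contra ez => /eqP ->.
    by rewrite iter_m redge_a redge_b.
  case: k k_gt0 k_le km => // k _ k_lt _.
  have -> : rg G (iter k.+1 phi y) = ra G (iter k phi y) by rewrite /= /phi /= rg_inv.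
  have [ez|ez] := eqVneq (redge G (ra G (iter k phi y))) (redge G y).
    rewrite tau_e //; rewrite redge_a in ez.
    case: (e_iter k (ltnW k_lt) ez) => k0; last by rewrite k0 ltnn in k_lt.
    by exists m; rewrite ?m_gt0 ?leqnn // k0 /= -rab_comm iter_m; left.
  rewrite tau_ne // ra_inv; exists k; last by left.
  rewrite (ltnW k_lt) andbT lt0n; apply: contra ez => /eqP ->.
  by rewrite redge_a.
case=> k /andP[k_gt0 k_le] [] E.
  by move: (idx_iter k k_le) k_gt0; rewrite -E findex0 => <-.
by have := s_iter k; have := s_g (iterS k); rewrite -E => ->; case: (s _).
Qed.

Lemma loop_orientableE :
  loop_orientable S (ra G) (rb G) y = (s (rb G y) != s y).
Proof.
rewrite /loop_orientable (ncycles_two tauK (@rg_inv n G) yS ayS cover_two).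
rewrite eqSS eqb1; have [sb|sb] := eqVneq (s (rb G y)) (s y).
  by rewrite loop_nonorientable.
rewrite r_sym loop_annulus //.
by move: sb; case: (s _) (s _) => -[].
Qed.

End Bouquet.

(** * Signs and cut sets on one component *)

Lemma bdry_connect_comp (n : nat) (G : ribbon_graph n) F (x y : rflag G) :
  connect (rel2 (bdry_map F) (rg G)) x y -> y \in Defs.comp x.
Proof.
apply: (connect_ind (P := fun z => z \in Defs.comp x)) => [z t|]; last exact: comp_refl.
case/comp_closed=> za zb zg /orP[]/eqP -> //; exact: swap_on_closed.
Qed.

(* Twisting the bipartition of the vertex circle by the two arcs gives a sign
   that changes along every edge, so it does not depend on the partial dual;
   it fails to change only on the free arcs where [side] switches. *)
Lemma po_comp_sgn (n : nat) (G : ribbon_graph n) (x : rflag G) :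
  po_comp x -> exists s : rflag G -> bool,
    (forall y, y \in Defs.comp x -> s (ra G y) = ~~ s y /\ s (rb G y) = ~~ s y) /\
    (#|[set y in Defs.comp x | s (rg G y) == s y]| <= 4)%N.
Proof.
case=> X [_ [one_v [side [side_a side4 side_b]]]].
pose H := pdual G X; pose S : {set rflag H} := Defs.comp x.
have SG y : y \in S -> [/\ ra G y \in S, rb G y \in S & rg G y \in S].
  exact: (@comp_closed n G x y).
have S_closed (y : rflag H) : y \in S -> [/\ ra H y \in S, rb H y \in S & rg H y \in S].
  by case/SG=> ya yb yg; split=> //; apply: swap_on_closed.
have S_vertex (y z : rflag H) : y \in S -> z \in S -> connect (rel2 (ra H) (rg H)) y z.
  move=> yS; move: z; apply/(@ncycles1P n H S _ _ y) => //; last exact/eqP.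
    exact: ra_inv.
  exact: rg_inv.
pose s0 := fconnect (rg H \o ra H) x.
have s0P y : y \in S -> s0 (ra H y) = ~~ s0 y /\ s0 (rg H y) = ~~ s0 y.
  move=> yS; apply: alternating_bipartite; [exact: ra_inv|exact: rg_inv
    |exact: ra_fpf|exact: rg_fpf|exact: S_vertex (comp_refl x) yS].
have s0a y : y \in S -> s0 (ra H y) = ~~ s0 y by case/s0P.
have s0g y : y \in S -> s0 (rg H y) = ~~ s0 y by case/s0P.
pose s (y : rflag G) := s0 y (+) side y.
have sa (y : rflag G) : y \in S -> s (pd_a X y) = ~~ s y.
  by move=> yS; rewrite /s side_a // [s0 _]s0a // addNb.
(* By the loop criterion [s0] changes along [pd_b X] exactly where [side] does not, so their sum
   always changes. *)
have sb (y : rflag G) : y \in S -> s (pd_b X y) = ~~ s y.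
  move=> yS; have := side_b y yS.
  rewrite [RHS](@loop_orientableE n H S S_closed S_vertex s0 s0a s0g y yS) /s /=.
  by case: (side _) (side _) (s0 _) (s0 _) => -[] [] [].
exists s; split=> [y yS|].
  have := sa y yS; have := sb y yS; rewrite /pd_a /pd_b /swap_on.
  by case: ifP.
apply: leq_trans side4; apply: subset_leq_card; apply/subsetP => y.
rewrite !inE => /andP[yS]; rewrite yS /s [s0 _]s0g ?inE //=.
by case: (s0 _) (side _) (side _) => -[] [].
Qed.

(** By the last clause only one boundary component inside C can meet Z, so if all of them do, there
    is just one. *)
Definition admissible (n : nat) (G : ribbon_graph n) (C : {set rflag G})
    (s : rflag G -> bool) (Z : {set rflag G}) : Prop :=
  [/\ Z != set0 /\ Z \subset C,
      forall y, y \in C -> s (ra G y) = ~~ s y /\ s (rb G y) = ~~ s y,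
      forall y, y \in C -> y \notin Z -> s (rg G y) = ~~ s y,
      forall y, y \in Z -> rg G y \in Z &
      forall F y z, y \in Z -> z \in Z ->
        connect (rel2 (bdry_map F) (rg G)) y z].

Lemma orientable_admissible (n : nat) (G : ribbon_graph n) (x : rflag G) :
  orientable_comp x -> exists s Z, admissible (Defs.comp x) s Z.
Proof.
case=> s sP; exists s, [set x; rg G x].
have neq_negb (b c : bool) : b != c -> b = ~~ c by case: b c => -[].
split.
- split; first by apply/set0Pn; exists x; rewrite !inE eqxx.
  apply/subsetP => y /set2P[]->; first exact: comp_refl.
  by case: (comp_closed (comp_refl x)).
- by move=> y /sP/and3P[/neq_negb ? /neq_negb ? _].
- by move=> y /sP/and3P[_ _ /neq_negb].
- by move=> y /set2P[]->; rewrite ?rg_inv !inE eqxx ?orbT.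
move=> F y z /set2P[]-> /set2P[]->; rewrite ?connect0 //;
  by apply: connect1; rewrite /rel2 ?rg_inv eqxx orbT.
Qed.

Lemma card_fiber_setD (T : finType) (O Z : {set T}) (P : pred T) :
  #|[set y in O | P y]| =
  (#|[set y in O :&: Z | P y]| + #|[set y in O :\: Z | P y]|)%N.
Proof.
rewrite -(cardsID Z); congr (_ + _)%N; apply: eq_card => y; rewrite !inE.
  by rewrite andbAC.
by rewrite andbA.
Qed.

(* On each boundary component the signs of the flags balance, hence so do the
   signs of the bad flags: a component through one bad arc passes through the
   bad arc of the other sign, and there are only two bad arcs. *)
Lemma po_admissible (n : nat) (G : ribbon_graph n) (x : rflag G) :
  po_comp x -> exists s Z, admissible (Defs.comp x) s Z.
Proof.
case/po_comp_sgn=> s [s_ab card4]; set Z := [set y in _ | _] in card4.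
(* With no bad flag [s] is a full bipartition, so the component is orientable and a single free arc
   serves as cut set. *)
have [Z0|Z_neq0] := eqVneq Z set0.
  apply: orientable_admissible; exists s => y yC.
  have [-> ->] := s_ab y yC; move/setP/(_ y): Z0; rewrite !inE in yC *.
  by rewrite yC => /negbT ->; case: (s y).
have ZP y : y \in Z -> y \in Defs.comp x /\ s (rg G y) = s y.
  by rewrite inE => /andP[-> /eqP].
have Zg y : y \in Z -> rg G y \in Z.
  case/ZP=> yC sy; case: (comp_closed yC) => _ _ ygC.
  by rewrite inE ygC rg_inv sy /=.
have sg y : y \in Defs.comp x -> y \notin Z -> s (rg G y) = ~~ s y.
  by move=> yC; rewrite inE yC; case: (s _) (s _) => -[].
exists s, Z; split=> //.
  by split=> //; apply/subsetP => y /ZP[].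
move=> F y z yZ; have [yC sy] := ZP y yZ.
set r := rel2 _ _; pose O := [set t | connect r y t].
have OC t : t \in O -> t \in Defs.comp x.
  by rewrite inE => /bdry_connect_comp; rewrite (comp_eq yC).
have Ob t : t \in O -> bdry_map F t \in O.
  by rewrite !inE => yt; apply: connect_trans yt (connect1 _); rewrite /r /rel2 eqxx.
have Og t : t \in O -> rg G t \in O.
  by rewrite !inE => yt; apply: connect_trans yt (connect1 _);
     rewrite /r /rel2 eqxx orbT.
have cO : #|[set t in O | s t == s y]| = #|[set t in O | s t != s y]|.
  apply: card_flip (@ra_inv n (pdual G F)) Ob _ => t /OC/s_ab[ta tb].
  by rewrite /= /pd_a /swap_on; case: ifP.
have cOZ : #|[set t in O :\: Z | s t == s y]| = #|[set t in O :\: Z | s t != s y]|.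
  apply: card_flip (@rg_inv n G) _ _ => t; rewrite inE => /andP[tZ tO].
    by rewrite inE Og // andbT; apply: contra tZ => /Zg; rewrite rg_inv.
  by rewrite sg ?OC.
have yO : y \in O by rewrite inE connect0.
(* The balances on O and on O minus Z force a bad flag on O of sign opposite to that of [y]. *)
have : (0 < #|[set t in O :&: Z | s t != s y]|)%N.
  move: cO; rewrite !(card_fiber_setD O Z) cOZ => /addIn <-.
  by apply/card_gt0P; exists y; rewrite inE eqxx andbT in_setI yO.
case/card_gt0P=> t; rewrite inE => /andP[/setIP[tO tZ] ts].
have [tC st] := ZP t tZ.
(* The ends of two free arcs of opposite signs are four flags, which is all that Z can hold. *)
pose W := y |: (rg G y |: [set t; rg G t]).
have WZO w : w \in W -> w \in Z /\ w \in O.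
  rewrite !in_setU1 in_set1 => /or4P[]/eqP ->; split=> //;
  by [exact: Zg|exact: Og].
have neq a b : s a = s y -> s b = s t -> (a == b) = false.
  by move=> ea eb; apply: contraNF ts => /eqP ab; rewrite -ea -eb ab.
have cW : #|W| = 4.
  rewrite !cardsU1 cards1 !inE [y == rg G y]eq_sym (negPf (rg_fpf y)).
  rewrite [t == rg G t]eq_sym (negPf (rg_fpf t)) (neq y t) // (neq y (rg G t)) //.
  by rewrite (neq (rg G y) t) // (neq (rg G y) (rg G t)).
have <- : W = Z.
  apply/eqP; rewrite eqEcard cW card4 andbT.
  by apply/subsetP => w /WZO[].
by case/WZO=> _; rewrite inE.
Qed.

(** * Assembly over all components *)

Theorem theorem1p3 (n : nat) (G : ribbon_graph n) :
  pseudo_orientable G -> hurwitz_stable (qt_poly G).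
Proof.
move=> poG; have adm (x : rflag G) : exists s Z, admissible (Defs.comp x) s Z.
  case: poG => [[x0 [po0 or0]]|[_ or0]]; last exact: orientable_admissible.
  have [xx0|/or0] := boolP (x \in Defs.comp x0); last exact: orientable_admissible.
  by rewrite (comp_eq xx0); apply: po_admissible.
(* The data is chosen per set C rather than per flag, so that all flags of a component share it;
   [(xpredT, set0)] is a dummy for sets that are not components. *)
have /fin_all_exists[p pP] (C : {set rflag G}) :
    exists sZ : (rflag G -> bool) * {set rflag G},
      [exists x, C == Defs.comp x] -> admissible C sZ.1 sZ.2.
  have [/existsP[x /eqP ->]|_] := boolP [exists x, C == Defs.comp x].
    by have [s [Z sZ]] := adm x; exists (s, Z).
  by exists (xpredT, set0).
have {adm pP} admP (x : rflag G) :
    admissible (Defs.comp x) (p (Defs.comp x)).1 (p (Defs.comp x)).2.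
  by apply: pP; apply/existsP; exists x.
pose sgn y := (p (Defs.comp y)).1 y.
pose Z := [set y | y \in (p (Defs.comp y)).2].
have comp_ra y : Defs.comp (ra G y) = Defs.comp y.
  by apply: comp_eq; case: (comp_closed (comp_refl y)).
have comp_rb y : Defs.comp (rb G y) = Defs.comp y.
  by apply: comp_eq; case: (comp_closed (comp_refl y)).
have comp_rg y : Defs.comp (rg G y) = Defs.comp y.
  by apply: comp_eq; case: (comp_closed (comp_refl y)).
have sgn_a y : sgn (ra G y) = ~~ sgn y.
  by rewrite /sgn comp_ra; case: (admP y) => _ /(_ y (comp_refl y))[].
have sgn_b y : sgn (rb G y) = ~~ sgn y.
  by rewrite /sgn comp_rb; case: (admP y) => _ /(_ y (comp_refl y))[].
have sgn_g y : y \notin Z -> sgn (rg G y) = ~~ sgn y.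
  by rewrite inE /sgn comp_rg; case: (admP y) => _ _ /(_ y (comp_refl y)).
have Z_g y : y \in Z -> rg G y \in Z.
  by rewrite !inE comp_rg; case: (admP y) => _ _ _ /(_ y).
have Z_comp y : exists2 z, z \in Z & z \in Defs.comp y.
  case: (admP y) => -[/set0Pn[z zZ] /subsetP ZC] _ _ _ _.
  by exists z; rewrite ?ZC // inE (comp_eq (ZC z zZ)).
(* If a component has one boundary component, that one meets Z; conversely, two boundary components
   in it would both meet Z, and admissibility joins them. *)
have qtE F : quasi_tree G F = cut_by Z F.
  have bK : involutive (bdry_map (G := G) F) := @ra_inv n (pdual G F).
  have r_sym := sym_connect_sym (rel2_sym bK (@rg_inv n G)).
  apply/forallP/forallP => [qt x|cut x].
    have [z zZ zx] := Z_comp x; apply/exists_inP; exists z => //.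
    by have /(ncycles1P bK (@rg_inv n G) (comp_refl x)) := qt x; apply.
  apply/(ncycles1P bK (@rg_inv n G) (comp_refl x)) => y yx.
  have [z zZ xz] := exists_inP (cut x); have [t tZ yt] := exists_inP (cut y).
  have zx := bdry_connect_comp xz; have tx := bdry_connect_comp yt.
  apply: connect_trans xz _; rewrite r_sym; apply: connect_trans yt _.
  rewrite (comp_eq yx) in tx; case: (admP x) => _ _ _ _; apply.
    by move: tZ; rewrite inE (comp_eq tx).
  by move: zZ; rewrite inE (comp_eq zx).
have /fin_all_exists[u uP] (e : 'I_n) : exists y, sgn y /\ redge G y = e.
  have [y ye] := redge_surj G e; have [sy|sy] := boolP (sgn y); first by exists y.
  by exists (ra G y); rewrite sgn_a redge_a.
move=> z z_pos.
(* The hypothesis takes the real part as a complex number; here it is moved to the real field. *)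
have z_pos' e : 0 < complex.Re (z e).
  by have := z_pos e; rewrite -complexRe ltcR.
rewrite /qt_poly raddf_sum /=.
under eq_bigr => F _ do rewrite rmorph_prod /=.
under eq_bigr => F _ do under eq_bigr => e _ do rewrite mevalXU.
under eq_bigl => F do rewrite qtE.
exact: (cut_sum_neq0 sgn_a sgn_b sgn_g Z_g Z_comp
  (fun e => (uP e).1) (fun e => (uP e).2) z_pos').
Qed.
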